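(* Let $k\geq 2$ and $t\geq 1$ be integers, and let $G$ be a $t$-connected graph of order $n$. If $n \ge \max\{ 6k+6t-1,\ k^2+tk+t+1\}$ and $$e(G) \ge {n-k-t \choose 2}+(k+t-1)^2+k+t,$$ then $G$ has a spanning $k$-ended tree unless $C_{n-1}(G) \cong K_t \nabla (K_{n-k-2t+1} \cup (k+t-1)K_{1})$.
   Context: All graphs are finite, simple and undirected; $e(G)$ is the number of edges of $G$. A graph is $t$-connected if it has more than $t$ vertices and remains connected whenever fewer than $t$ vertices are removed. For an integer $k\ge 2$, a spanning $k$-ended tree of a connected graph is a spanning tree with at most $k$ leaves (vertices of degree one). For an integer $l\ge 0$, the $l$-closure $C_l(G)$ of $G$ is the graph obtained from $G$ by recursively joining pairs of non-adjacent vertices whose degree sum (in the current graph) is at least $l$ until no such pair remains. $K_m$ is the complete graph on $m$ vertices, $mK_1$ is the empty graph on $m$ vertices, $\cup$ denotes disjoint union, and $G_1\nabla G_2$ (the join) is obtained from $G_1\cup G_2$ by adding all edges between $G_1$ and $G_2$. *)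

(* Defs.v *)
From mathcomp Require Import all_boot.

Set Implicit Arguments.
Unset Strict Implicit.
Unset Printing Implicit Defensive.

Record sgraph (T : finType) := SGraph {
  adj :> rel T;
  adj_sym : symmetric adj;
  adj_irrefl : irreflexive adj
}.

Definition edges (T : finType) (G : sgraph T) : {set {set T}} :=
  [set [set x; y] | x in [set: T], y in [set: T] & G x y].

Definition deg (T : finType) (G : sgraph T) (x : T) : nat := #|[set y | G x y]|.

Definition connected (T : finType) (G : sgraph T) : Prop :=
  0 < #|T| /\ forall x y : T, connect G x y.

Definition induced_adj (T : finType) (G : sgraph T) (A : {set T}) :
  rel {x : T | x \in A} := fun u v => G (val u) (val v).

Definition induced (T : finType) (G : sgraph T) (A : {set T}) :
  sgraph {x : T | x \in A}.
Proof.
exists (@induced_adj T G A) => [u v|u]; [exact: adj_sym | exact: adj_irrefl].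
Defined.

Definition t_connected (t : nat) (T : finType) (G : sgraph T) : Prop :=
  t < #|T| /\ forall S : {set T}, #|S| < t -> connected (induced G (~: S)).

(* [ucycle] also accepts the walks [x; y] going back and forth along an edge,
   whence the bound on the length. *)
Definition acyclic (T : finType) (G : sgraph T) : Prop :=
  forall c : seq T, ucycle G c -> size c <= 2.

Definition is_tree (T : finType) (G : sgraph T) : Prop :=
  connected G /\ acyclic G.

Definition leaves (T : finType) (G : sgraph T) : {set T} :=
  [set x | deg G x == 1].

Definition has_spanning_ended_tree (k : nat) (T : finType) (G : sgraph T) : Prop :=
  exists F : sgraph T, [/\ subrel F G, is_tree F & #|leaves F| <= k].

Definition iso (T U : finType) (G : sgraph T) (H : sgraph U) : Prop :=
  exists2 f : T -> U, bijective f & forall x y, H (f x) (f y) = G x y.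

Definition complete (m : nat) : sgraph 'I_m.
Proof. by exists (fun x y => x != y) => [x y|x]; rewrite ?eqxx // eq_sym. Defined.

Definition empty (m : nat) : sgraph 'I_m.
Proof. by exists (fun _ _ => false). Defined.

Definition dunion_adj (T U : finType) (G : sgraph T) (H : sgraph U) : rel (T + U) :=
  fun u v => match u, v with
  | inl x, inl y => G x y
  | inr x, inr y => H x y
  | _, _ => false
  end.

Definition dunion (T U : finType) (G : sgraph T) (H : sgraph U) : sgraph (T + U)%type.
Proof.
by exists (dunion_adj G H) => [[x|x] [y|y]|[x|x]] //=; rewrite ?adj_irrefl // adj_sym.
Defined.

Definition join_adj (T U : finType) (G : sgraph T) (H : sgraph U) : rel (T + U) :=
  fun u v => match u, v with
  | inl x, inl y => G x y
  | inr x, inr y => H x y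
  | _, _ => true
  end.

Definition join (T U : finType) (G : sgraph T) (H : sgraph U) : sgraph (T + U)%type.
Proof.
by exists (join_adj G H) => [[x|x] [y|y]|[x|x]] //=; rewrite ?adj_irrefl // adj_sym.
Defined.

Definition add_edge (T : finType) (G : sgraph T) (x y : T) : sgraph T.
Proof.
exists (fun u v => G u v || (u != v) && ([set u; v] == [set x; y])) => [u v|u].
  by rewrite adj_sym eq_sym setUC.
by rewrite adj_irrefl eqxx.
Defined.

Definition joinable (l : nat) (T : finType) (G : sgraph T) (p : T * T) : bool :=
  [&& p.1 != p.2, ~~ G p.1 p.2 & l <= deg G p.1 + deg G p.2].

Definition closure_step (l : nat) (T : finType) (G : sgraph T) : sgraph T :=
  if [pick p | joinable l G p] is Some p then add_edge G p.1 p.2 else G.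

(* The number of iterations only has to be large enough for the process to stop,
   and the choice of the joined pairs is irrelevant: see [lclosure_unique]. *)
Definition lclosure (l : nat) (T : finType) (G : sgraph T) : sgraph T :=
  iter (#|T| * #|T|) (@closure_step l T) G.

Inductive joins (l : nat) (T : finType) (G : sgraph T) : sgraph T -> Prop :=
| joins_refl : joins l G G
| joins_step H p : joins l G H -> joinable l H p -> joins l G (add_edge H p.1 p.2).

Lemma lclosure_joins (l : nat) (T : finType) (G : sgraph T) : joins l G (lclosure l G).
Proof.
rewrite /lclosure; elim: (_ * _) => [|m IH]; first exact: joins_refl.
rewrite iterS {1}/closure_step; case: pickP => [p pP|_] //.
exact: joins_step.
Qed.

Lemma lclosure_stop (l : nat) (T : finType) (G : sgraph T) p :
  ~~ joinable l (lclosure l G) p.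
Proof.
pose N (H : sgraph T) := [set p : T * T | ~~ H p.1 p.2].
have key m : (forall p, ~~ joinable l (iter m (@closure_step l T) G) p) \/
    #|N (iter m (@closure_step l T) G)| + m <= #|T| * #|T|.
  elim: m => [|m IH].
    by right; rewrite addn0 -card_prod max_card.
  rewrite iterS; set H := iter m _ G in IH *.
  rewrite /closure_step; case: pickP => [q qP|nP]; last first.
    by left => q; rewrite nP.
  case: IH => [/(_ q)|IH]; first by rewrite qP.
  right; rewrite addnS; apply: leq_trans IH.
  rewrite -addSn leq_add2r; apply: proper_card; apply/properP; split.
    by apply/subsetP => r; rewrite !inE /= negb_or => /andP[].
  case/and3P: qP => q1 q2 _; exists q; rewrite !inE //=.
  by rewrite q1 eqxx orbT.
have [H|] := key (#|T| * #|T|); first exact: H.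
rewrite -/(lclosure l G) -[X in _ <= X]add0n leq_add2r leqn0 cards_eq0 => /eqP N0.
apply/negP => /and3P[_ pN _].
by have := in_set0 p; rewrite -N0 inE pN.
Qed.

Lemma lclosure_unique (l : nat) (T : finType) (G H : sgraph T) :
  joins l G H -> (forall p, ~~ joinable l H p) -> H =2 lclosure l G.
Proof.
have sub (A B : sgraph T) : joins l G A -> joins l G B ->
    (forall p, ~~ joinable l B p) -> subrel A B.
  move=> GA GB stopB.
  elim: GA => [|A' [x y] _ IH /and3P[/= xy _ lxy] u v /=].
    by elim: GB {stopB} => [|B' q _ IH _] u v // /IH /= ->.
  case/orP => [/IH //|/andP[uv /eqP uvE]].
  have dle z : deg A' z <= deg B z.
    by apply/subset_leq_card/subsetP => w; rewrite !inE => /IH.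
  have Bxy : B x y.
    have := stopB (x, y); rewrite /joinable /= xy /=.
    by rewrite (leq_trans lxy (leq_add (dle x) (dle y))) andbT negbK.
  have ux : u \in [set x; y] by rewrite -uvE !inE eqxx.
  have vx : v \in [set x; y] by rewrite -uvE !inE eqxx orbT.
  move: ux vx uv; rewrite !inE => /orP[]/eqP-> /orP[]/eqP->; rewrite ?eqxx //.
  by rewrite adj_sym.
move=> GH stopH u v; apply/idP/idP; apply: sub => //; try exact: lclosure_joins.
exact: lclosure_stop.
Qed.

(* Main.v *)
Require Import Defs.
From mathcomp Require Import all_boot.
From mathcomp Require Import perm.
From mathcomp Require Import zify.

Set Implicit Arguments.
Unset Strict Implicit.
Unset Printing Implicit Defensive.

(** Joining two non-adjacent vertices [u], [v] of degree sum at least [n - 1] creates no new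
    spanning [k]-ended tree: if a tree uses [uv], an exchange along the children of the
    neighbours of [u] and [v], in the two halves left by [uv], gives a tree of [G] with no
    more leaves. So one may replace [G] by its closure [H].

    Non-adjacent vertices of [H] have degree sum at most [n - 2], so the vertices outside a
    maximum clique [C] have degree less than [r = n - #|C|], and counting edges gives
    [r <= k + t - 1].

    Adding a dominating vertex turns paths into cycles. A longest cycle contains [C], and
    the Chvatal-Erdos rotation shows that it contains at least [t] of the [r] other vertices
    or all of them. Unless it contains exactly [t] of them and [r = k + t - 1], it misses at
    most [k - 2] vertices and extends to a tree with at most [k] leaves. In the remaining
    case, exchanges along the cycle and closedness show that all vertices outside [C] have
    the same [t] neighbours, all in [C], and [H] is the exceptional graph. *)

(** * Rooted trees *)

Lemma next_neq_prev (T : eqType) (c : seq T) x :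
  uniq c -> 2 < size c -> x \in c -> next c x != prev c x.
Proof.
move=> uc sc xc; have [i s E] := rot_to xc.
rewrite -(next_rot i uc) -(prev_rot i uc).
have us : uniq (x :: s) by rewrite -E rot_uniq.
have : 2 < size (x :: s) by rewrite -E size_rot.
rewrite E next_nth prev_nth mem_head /= eqxx => szs.
have /= /andP[xs us'] := us; rewrite memNindex // nth_last.
case: s us' szs {E us xs} => [|b [|d s]] //= /andP[bs _] _.
by apply: contraNneq bs => ->; rewrite mem_last.
Qed.

Section RootedTree.

Variables (T : finType) (z : T) (par : T -> T).

(** A tree is encoded by its parent map; the value of [par] at the root [z] is a dummy. *)
Definition rooted_adj : rel T :=
  fun x y => (x != z) && (par x == y) || (y != z) && (par y == x).

Hypothesis to_root : forall x, fconnect par x z.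

Lemma rooted_rank :
  exists rho : T -> nat, forall x, x != z -> rho (par x) < rho x.
Proof.
have ex x : exists m, iter m par x == z.
  by exists (findex par x z); rewrite iter_findex.
exists (fun x => ex_minn (ex x)) => x xz.
case: (ex_minnP (ex x)) => [[|m] /= /eqP hm _]; first by rewrite hm eqxx in xz.
case: ex_minnP => m' _; apply; by rewrite -iterSr iterS hm.
Qed.

Lemma rooted_adj_sym : symmetric rooted_adj.
Proof. by move=> x y; rewrite /rooted_adj orbC. Qed.

Lemma rooted_adj_irrefl : irreflexive rooted_adj.
Proof.
have [rho hrho] := rooted_rank.
move=> x; rewrite /rooted_adj orbb; apply/negP => /andP[/hrho + /eqP E].
by rewrite E ltnn.
Qed.

Definition rooted_tree : sgraph T := SGraph rooted_adj_sym rooted_adj_irrefl.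

Lemma rooted_tree_connect x : connect rooted_adj x z.
Proof.
have [rho hrho] := rooted_rank.
have [m] := ubnP (rho x); elim: m x => // m IH x hx.
have [->|xz] := eqVneq x z; first exact: connect0.
apply: (@connect_trans _ _ (par x)); last by apply: IH; have := hrho _ xz; lia.
by apply: connect1; rewrite /rooted_adj xz eqxx.
Qed.

(** On a cycle of length at least three, both cyclic neighbours of a vertex of maximum rank would
    have to be its parent, against [next_neq_prev]. *)
Lemma rooted_tree_is_tree : is_tree rooted_tree.
Proof.
split; first split; first by apply/card_gt0P; exists z.
  move=> x y; apply: (@connect_trans _ _ z); first exact: rooted_tree_connect.
  by rewrite (sym_connect_sym rooted_adj_sym) rooted_tree_connect.
have [rho hrho] := rooted_rank.
move=> c /andP[cyc uc]; rewrite leqNgt; apply/negP => szc.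
have [x0 x0c] : exists x0, x0 \in c by case: c szc {cyc uc} => // x0 ? _; exists x0; rewrite inE eqxx.
case: (arg_maxnP rho x0c) => a ac amax.
have nb b : b \in c -> rooted_adj a b -> par a = b.
  move=> bc /orP[/andP[_ /eqP //]|/andP[bz /eqP E]].
  by have := hrho _ bz; rewrite E ltnNge => /negP[]; apply: amax.
have /negP[] := next_neq_prev uc szc ac.
have <- : par a = next c a.
  by apply: nb; rewrite ?mem_next //; exact: (next_cycle cyc).
apply/eqP/nb; rewrite ?mem_prev // rooted_adj_sym; exact: (prev_cycle cyc).
Qed.

Lemma deg_rooted_tree x :
  deg rooted_tree x = #|[set y | (y != z) && (par y == x)]| + (x != z).
Proof.
have [rho hrho] := rooted_rank.
have -> : deg rooted_tree x =
    #|[set y | (y != z) && (par y == x)] :|: [set y | (x != z) && (y == par x)]|.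
  apply: eq_card => y; rewrite !inE /= /rooted_adj orbC; congr (_ || _ && _).
  exact: eq_sym.
rewrite cardsU.
have -> : #|[set y | (x != z) && (y == par x)]| = (x != z).
  have [_|xz] := eqVneq x z; last by rewrite /= -(cards1 (par x)); apply: eq_card => y; rewrite !inE.
  by apply: eq_card0 => y; rewrite !inE.
rewrite (_ : _ :&: _ = set0) ?cards0 ?subn0 //.
apply/setP => y; rewrite !inE; apply/negP => /andP[/andP[yz /eqP E] /andP[xz /eqP E']].
by have := hrho _ yz; have := hrho _ xz; rewrite -E' E; lia.
Qed.

End RootedTree.

Lemma connect_boundary (T : finType) (e : rel T) (A : {pred T}) x y :
  connect e x y -> x \in A -> y \notin A ->
  exists a b, [/\ a \in A, b \notin A & e a b].
Proof.
case/connectP => p + ->; elim: p x => [|a p IH] x /=; first by move=> _ ->.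
case/andP=> xa pa xA lA; have [aA|aA] := boolP (a \in A); last by exists x, a.
exact: IH pa aA lA.
Qed.

(** The induction enlarges [A] by one adjacent vertex at a time. Starting from a set rather than a
    root lets [path_spanning_tree] keep a whole path inside the tree. *)
Lemma connected_parent (T : finType) (G : sgraph T) (A : {set T}) :
  (forall x y, connect G x y) -> A != set0 ->
  exists (par : T -> T) (rho : T -> nat),
    forall x, x \notin A -> G x (par x) /\ rho (par x) < rho x.
Proof.
move=> conG; have [m] := ubnP #|~: A|; elim: m A => // m IH A hA /set0Pn[a0 a0A].
have [A0|/set0Pn[b0]] := eqVneq (~: A) set0.
  by exists id, (fun=> 0) => x; rewrite -in_setC A0 inE.
rewrite inE => b0A.
have [a [x [aA xA ax]]] := connect_boundary (conG a0 b0) a0A b0A.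
have [||par [rho hp]] := IH (x |: A).
- rewrite ltnS in hA; apply: leq_trans hA; apply: proper_card; apply/properP; split.
    by apply/subsetP => y; rewrite !inE negb_or => /andP[].
  by exists x; rewrite !inE ?xA // eqxx.
- by apply/set0Pn; exists x; rewrite !inE eqxx.
exists (fun y => if y == x then a else par y).
(* The new vertex [x] gets rank 1, just above [A]; the other ranks are shifted by two to stay above
   both. *)
exists (fun y => if y \in A then 0 else if y == x then 1 else (rho y).+2) => y yA.
rewrite (negbTE yA); have [->|yx] := eqVneq y x; first by rewrite adj_sym ax aA.
have [|-> hr] := hp y; first by rewrite !inE negb_or yx.
by split=> //; case: ifP => // _; case: ifP.
Qed.

Lemma ranked_fconnect (T : finType) (par : T -> T) (rho : T -> nat) z :
  (forall x, x != z -> rho (par x) < rho x) -> forall x, fconnect par x z.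
Proof.
move=> hr x; have [m] := ubnP (rho x); elim: m x => // m IH x hx.
have [->|xz] := eqVneq x z; first exact: connect0.
apply: (@connect_trans _ _ (par x)); first exact: fconnect1.
by apply: IH; have := hr _ xz; lia.
Qed.

(** A simple [e]-path from [x] to [y] closes up with the edge [xy] to a cycle of [F]. Such a cycle
    has length at most two, so the path is the edge itself. *)
Lemma acyclic_edge (T : finType) (F : sgraph T) (e : rel T) x y :
  acyclic F -> subrel e F -> F x y -> connect e x y -> e x y.
Proof.
move=> acF eF Fxy /connectP[p pth E]; case/shortenP: pth E => p' pth' up _ E.
have := acF (x :: p'); case: p' pth' up E => [|b [|c p']] pth' up E.
- by rewrite E /= adj_irrefl in Fxy.
- by move: pth' => /=; rewrite E /= andbT.
have /[swap]/[apply] // : ucycle F [:: x, b, c & p'].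
rewrite /ucycle up andbT /cycle rcons_path (sub_path eF pth') /=.
by rewrite adj_sym [last _ _](esym E).
Qed.

(** The parent map from [connected_parent] gives a spanning subtree of [F]; by [acyclic_edge], [F]
    has no further edge. *)
Lemma tree_parent (T : finType) (F : sgraph T) z :
  is_tree F -> exists2 par : T -> T,
    forall x, fconnect par x z & F =2 rooted_adj z par.
Proof.
case=> -[_ conF] acF.
have [|par [rho hp]] := @connected_parent T F [set z] conF.
  by apply/set0Pn; exists z; rewrite inE.
have tr : forall x, fconnect par x z.
  by apply: (@ranked_fconnect _ _ rho) => x xz; case: (hp x); rewrite ?inE.
exists par => //.
have hF x : x != z -> F x (par x) by move=> xz; case: (hp x); rewrite ?inE.
have sub : subrel (rooted_adj z par) F.
  by move=> x y /orP[]/andP[xz /eqP <-]; [|rewrite adj_sym]; apply: hF.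
move=> x y; apply/idP/idP => [Fxy|]; last exact: sub.
apply: (acyclic_edge acF sub Fxy).
by case: (rooted_tree_is_tree tr) => -[_ + _]; apply.
Qed.

Lemma spanning_ended_treeI (T : finType) (G : sgraph T) k z (par : T -> T)
    (tr : forall x, fconnect par x z) :
  (forall x, x != z -> G x (par x)) -> #|leaves (rooted_tree tr)| <= k ->
  has_spanning_ended_tree k G.
Proof.
move=> hG lk; exists (rooted_tree tr); split=> //; last exact: rooted_tree_is_tree.
by move=> x y /orP[]/andP[xz /eqP <-]; [|rewrite adj_sym]; apply: hG.
Qed.

(** * Exchanging an edge of a spanning tree *)

Section CloseEdge.

Variables (T : finType) (G F : sgraph T) (u v : T) (k : nat).
Hypotheses (neq_uv : u != v) (nGuv : ~~ G u v) (Fuv : F u v).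
Hypothesis FG : forall x y, F x y -> [set x; y] != [set u; v] -> G x y.
Hypotheses (tF : is_tree F) (lF : #|leaves F| <= k).

Definition cut_edge : rel T := [rel x y | F x y && ([set x; y] != [set u; v])].

Definition far_side : {set T} := [set x | connect cut_edge v x].

Lemma cut_edge_sym : symmetric cut_edge.
Proof. by move=> x y; rewrite /cut_edge /= adj_sym setUC. Qed.

Lemma near_notin_far_side : u \notin far_side.
Proof.
rewrite inE (sym_connect_sym cut_edge_sym); apply/negP => con.
have sub : subrel cut_edge F by move=> x y /andP[].
by have := acyclic_edge (proj2 tF) sub Fuv con; rewrite /cut_edge /= eqxx andbF.
Qed.

(** Root [F] at [v], so that [u] is a child of [v], and let [x] be a [G]-neighbour of [u] on the far
    side. If [x] has no child, hang [u] on [x]: the leaf [x] is lost and at most [v] becomes a leaf.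
    If [x] has a child [y] adjacent to [v], hang [u] on [x] and [y] on [v]: all degrees are kept.
    Otherwise every such [x] has a child that is not adjacent to [v], and counting these children
    gives the inequality. *)
Lemma close_edge_side :
  has_spanning_ended_tree k G \/
  #|[set x in far_side | G u x]| + #|[set x in far_side | G v x]| < #|far_side|.
Proof.
have [par tr FE] := tree_parent v tF; have [rho hrho] := rooted_rank tr.
have degE x : deg F x = deg (rooted_tree tr) x.
  by apply: eq_card => y; rewrite !inE FE.
have paru : par u = v.
  by move: Fuv; rewrite FE /rooted_adj neq_uv eqxx orbF => /eqP.
have vS : v \in far_side by rewrite inE.
have cutP a : a != v -> a != u -> cut_edge a (par a).
  move=> av au; rewrite /cut_edge /= FE /rooted_adj av eqxx /=.
  apply/eqP => /setP/(_ a); by rewrite !inE eqxx (negbTE av) (negbTE au).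
have parG a : a != v -> a != u -> G a (par a).
  by move=> av au; have /andP[Fa] := cutP _ av au; apply: FG.
have Su a : a \in far_side -> a != u by apply: contraTneq => ->; exact: near_notin_far_side.
have Spar a : a != v -> a != u -> (par a \in far_side) = (a \in far_side).
  move=> av au; rewrite !inE; apply/idP/idP => con.
    by apply: connect_trans con (connect1 _); rewrite cut_edge_sym cutP.
  by apply: connect_trans con (connect1 _); rewrite cutP.
(* Only vertices ranked above [x] may be moved to [v], so the ancestors of [x] keep their parents.
   Thus [x] still reaches [v], and [u] does so through [x]. *)
have reroute par' x : x \in far_side -> par' u = x ->
    (forall a, a != v -> a != u -> par' a = par a \/ (par' a = v /\ rho x < rho a)) ->
    forall a, fconnect par' a v.
  move=> xS par'u par'P.
  have low a : a \in far_side -> rho a <= rho x -> fconnect par' a v.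
    have [m] := ubnP (rho a); elim: m a => // m IH a ha aS ax.
    have [->|av] := eqVneq a v; first exact: connect0.
    apply: connect_trans (fconnect1 _ _) _.
    have au := Su _ aS; have ra := hrho _ av.
    case: (par'P a av au) => [->|[_]]; last by lia.
    by apply: IH; rewrite ?Spar //; lia.
  move=> a; have [m] := ubnP (rho a); elim: m a => // m IH a ha.
  have [->|av] := eqVneq a v; first exact: connect0.
  apply: connect_trans (fconnect1 _ _) _.
  have [->|au] := eqVneq a u; first by rewrite par'u; apply: low.
  have ra := hrho _ av.
  by case: (par'P a av au) => [->|[-> _]]; [apply: IH; lia | exact: connect0].
pose S := [set x in far_side | G u x].
pose N := [set x in far_side | G v x].
have Sv x : x \in S -> x != v.
  by rewrite inE => /andP[_ ux]; apply: contraNneq nGuv => <-.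
have [/existsP[x /andP[xS /forallP nch]]|/existsPn ch] :=
  boolP [exists x, (x \in S) && [forall y, (y != v) ==> (par y != x)]].
  left; have xv := Sv _ xS; move: xS; rewrite inE => /andP[xF Gux].
  have xu := Su _ xF.
  pose par' a := if a == u then x else par a.
  have tr' : forall a, fconnect par' a v.
    apply: (reroute par' x); rewrite // /par' ?eqxx // => a av au.
    by left; rewrite (negbTE au).
  apply: (spanning_ended_treeI (tr := tr')).
    move=> a av; rewrite /par'; case: eqVneq => [-> //|au]; exact: parG.
  apply: leq_trans lF.
  have xl : x \in leaves F.
    rewrite inE degE deg_rooted_tree xv (_ : [set _ | _] = set0) ?cards0 //.
    by apply/setP => y; rewrite !inE; have := nch y; case: (y != v) => //= /negbTE.
  apply: (@leq_trans #|v |: leaves F :\ x|); last first.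
    by rewrite (cardsD1 x (leaves F)) xl cardsU1; case: (_ \notin _).
  apply: subset_leq_card; apply/subsetP => a; rewrite !inE degE !deg_rooted_tree.
  have [//|av] := eqVneq a v => /= /eqP E.
  have [ax|ax] := eqVneq a x.
    have : 0 < #|[set y | (y != v) && (par' y == a)]|.
      by apply/card_gt0P; exists u; rewrite !inE /par' eqxx neq_uv ax eqxx.
    by lia.
  rewrite /= -[X in _ == X]E eqn_add2r; apply/eqP/eq_card => y; rewrite !inE /par'.
  have [->|//] := eqVneq y u.
  by rewrite paru ![_ == a]eq_sym (negbTE av) (negbTE ax).
have [/existsP[y /and3P[yv yS Gvy]]|/existsPn nch] :=
  boolP [exists y, [&& y != v, par y \in S & G v y]].
  left; set x := par y in yS; have xv := Sv _ yS.
  move: yS; rewrite inE => /andP[xF Gux].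
  have yu : y != u by apply: contraNneq xv => yu; rewrite /x yu paru.
  (* Exchanging the parents of [u] and [y] preserves the number of children of every
     vertex, hence all degrees. *)
  pose par' := par \o tperm u y.
  have par'D a : a != u -> a != y -> par' a = par a.
    by move=> au ay; rewrite /par' /= tpermD // eq_sym.
  have tr' : forall a, fconnect par' a v.
    apply: (reroute par' x); rewrite // /par' /= ?tpermL // => a av au.
    have [->|ay] := eqVneq a y; last by left; exact: par'D.
    by right; rewrite tpermR; split=> //; exact: hrho.
  apply: (spanning_ended_treeI (tr := tr')).
    move=> a av; have [->|au] := eqVneq a u; first by rewrite /par' /= tpermL.
    have [->|ay] := eqVneq a y; first by rewrite /par' /= tpermR paru adj_sym.
    by rewrite par'D //; exact: parG.
  apply: leq_trans lF; apply: subset_leq_card; apply/subsetP => a.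
  rewrite !inE degE !deg_rooted_tree => /eqP <-; rewrite eqn_add2r.
  rewrite -(card_preimset _ (@perm_inj _ (tperm u y))).
  apply/eqP/eq_card => b; rewrite !inE; congr (_ && _).
  by case: tpermP => // ->; rewrite (negbTE yv) (negbTE neq_uv).
right; rewrite -/S -/N.
have vN : v \notin N by rewrite inE adj_irrefl andbF.
have NS : N \subset far_side :\ v.
  apply/subsetP => a aN; rewrite in_setD1; move: (aN); rewrite inE => /andP[-> _].
  by rewrite andbT; apply: contraNneq vN => <-.
(* No exchange applies: each element of [S] is the parent of a vertex of the far side other than [v]
   and outside [N]. *)
have SP : S \subset par @: (far_side :\ v :\: N).
  apply/subsetP => x xS; have := ch x; rewrite xS /= => /forallPn[y].
  rewrite negb_imply negbK => /andP[yv /eqP E].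
  have yu : y != u by apply: contraNneq (Sv _ xS) => yu; rewrite -E yu paru.
  have := nch y; rewrite yv E xS /= => nvy.
  apply/imsetP; exists y => //; rewrite !inE yv (negbTE nvy) andbF /=.
  by rewrite -in_set -/far_side -Spar // E; move: xS; rewrite inE => /andP[].
have := subset_leq_card SP; have := leq_imset_card par (far_side :\ v :\: N).
rewrite cardsD (setIidPr NS); have := subset_leq_card NS.
by rewrite (cardsD1 v far_side) vS; lia.
Qed.

End CloseEdge.

(** Without its edge [uv], the tree splits the vertices into two sides. If [close_edge_side] gave
    the inequality on both, adding them would bound the degree sum of [u] and [v] by [#|T| - 2]. *)
Lemma spanning_tree_add_edge (T : finType) (G : sgraph T) k u v :
  u != v -> ~~ G u v -> #|T| - 1 <= deg G u + deg G v ->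
  has_spanning_ended_tree k (add_edge G u v) -> has_spanning_ended_tree k G.
Proof.
move=> uv nG dG [F [FG tF lF]].
have FG' x y : F x y -> [set x; y] != [set u; v] -> G x y.
  by move=> /FG /= /orP[//|/andP[_ ->]].
have [Fuv|nF] := boolP (F u v); last first.
  exists F; split=> // x y Fxy; apply: FG' => //; apply: contraNneq nF => E.
  have : x \in [set u; v] by rewrite -E !inE eqxx.
  have : y \in [set u; v] by rewrite -E !inE eqxx orbT.
  rewrite !inE => /orP[]/eqP Ey /orP[]/eqP Ex; move: Fxy; rewrite Ex Ey ?adj_irrefl //.
  by rewrite adj_sym.
have vu : v != u by rewrite eq_sym.
have Fvu : F v u by rewrite adj_sym.
have nG' : ~~ G v u by rewrite adj_sym.
have FG'' x y : F x y -> [set x; y] != [set v; u] -> G x y by rewrite (setUC [set v]); apply: FG'.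
case: (close_edge_side uv nG Fuv FG' tF lF) => // side_v.
case: (close_edge_side vu nG' Fvu FG'' tF lF) => // side_u.
have cutE : cut_edge F v u =2 cut_edge F u v by move=> x y; rewrite /cut_edge /= (setUC [set v]).
set A := far_side F u v in side_v; set B := far_side F v u in side_u.
have AB : #|A| + #|B| <= #|T|.
  rewrite -cardsUI (_ : A :&: B = set0) ?cards0 ?addn0 ?max_card //.
  apply/setP => x; rewrite !inE (eq_connect cutE); apply/negP => /andP[vx ux].
  have := near_notin_far_side Fuv tF; rewrite inE; apply/negP/negPn.
  by apply: connect_trans vx _; rewrite (sym_connect_sym (@cut_edge_sym _ F u v)).
have cov x : (x \in A) || (x \in B).
  have [//|nx] := boolP (_ || _); have vA : v \in A by rewrite inE.
  have uB : u \in B by rewrite inE.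
  have vAB : v \in A :|: B by rewrite inE vA.
  have xAB : x \notin A :|: B by rewrite in_setU.
  case: tF => -[_ /(_ v x) con] _.
  have [a [b [aAB bAB Fab]]] := connect_boundary con vAB xAB.
  move: bAB; rewrite in_setU negb_or => /andP[bA bB].
  have cab : cut_edge F u v a b.
    rewrite /cut_edge /= Fab; apply/eqP => /setP/(_ b); rewrite !inE eqxx orbT.
    by case/esym/orP => /eqP E; rewrite E ?uB ?vA in bA bB.
  move: aAB; rewrite in_setU => /orP[aA|aB].
    by case/negP: bA; move: aA; rewrite !inE => /connect_trans; apply; exact: connect1.
  case/negP: bB; move: aB; rewrite !inE !(eq_connect cutE) => /connect_trans; apply.
  exact: connect1.
have deg_le w : deg G w <= #|[set x in A | G w x]| + #|[set x in B | G w x]|.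
  apply: leq_trans (_ : #|[set x in A | G w x] :|: [set x in B | G w x]| <= _).
    by apply/subset_leq_card/subsetP => x; have := cov x; rewrite !inE => + ->; rewrite !andbT.
  by rewrite cardsU leq_subr.
by have := deg_le u; have := deg_le v; lia.
Qed.

Lemma spanning_tree_joins (T : finType) (G H : sgraph T) k :
  joins (#|T| - 1) G H -> has_spanning_ended_tree k H -> has_spanning_ended_tree k G.
Proof.
elim=> [//|H' [u v] _ IH /and3P[/= uv nuv duv] tH]; apply: IH.
exact: spanning_tree_add_edge tH.
Qed.

(** * Longest cycles in a graph with a large clique *)

Lemma rot_next (T : eqType) (c : seq T) x : uniq c -> x \in c ->
  exists i s, rot i c = next c x :: s /\ last (next c x) s = x.
Proof.
move=> uc xc; have nc : next c x \in c by rewrite mem_next.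
have [i s E] := rot_to nc; exists i, s; split=> //.
have us : uniq (next c x :: s) by rewrite -E rot_uniq.
rewrite -[RHS](prev_next uc) -(prev_rot i uc) E prev_nth mem_head.
by case/andP: us => ns _; rewrite memNindex // nth_last.
Qed.

Lemma next_neq (T : eqType) (c : seq T) x :
  uniq c -> 1 < size c -> x \in c -> next c x != x.
Proof.
move=> uc sc xc; have [i [s [E l]]] := rot_next uc xc.
have us : uniq (next c x :: s) by rewrite -E rot_uniq.
have : 1 < size (next c x :: s) by rewrite -E size_rot.
case: s us l {E} => //= a s /andP[ns _] l _; apply: contraNneq ns => E.
by rewrite {1}E -l mem_last.
Qed.

Section LongestCycle.

Variables (T : finType) (H : sgraph T) (C : {set T}) (t : nat).
Hypothesis clique : {in C &, forall x y, x != y -> H x y}.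
Hypothesis big : 2 * #|~: C| < #|C|.
Hypothesis C_gt2 : 2 < #|C|.
Hypothesis sep : forall S : {set T}, #|S| < t -> forall x y,
  x \notin S -> y \notin S -> connect [rel a b | H a b && (b \notin S)] x y.

Definition longest_cycle (c : seq T) :=
  ucycle H c /\ forall c', ucycle H c' -> size c' <= size c.

Definition off_cycle (c : seq T) : rel T :=
  [rel a b | [&& H a b, a \notin c & b \notin c]].

(** For [w] off [c], these are the vertices of attachment of the bridge of [c] containing [w]. *)
Definition attach (c : seq T) (w : T) : {set T} :=
  [set x | (x \in c) && [exists b, connect (off_cycle c) w b && H b x]].

Definition rest_on (c : seq T) : {set T} := [set v in c | v \notin C].

Lemma ex_longest_cycle : exists c, longest_cycle c.
Proof.
pose P m := [exists c : m.-tuple T, cycle H c && uniq c].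
have exP : exists m, P m by exists 0; apply/existsP; exists [tuple].
have ubP m : P m -> m <= #|T|.
  by case/existsP=> c /andP[_ uc]; rewrite -(size_tuple c) -(card_uniqP uc) max_card.
case: (ex_maxnP exP ubP) => m /existsP[c /andP[cc uc]] maxm.
exists c; split=> [|c' /andP[cc' uc']]; first exact/andP.
by rewrite size_tuple; apply: maxm; apply/existsP; exists (in_tuple c'); rewrite cc' uc'.
Qed.

Lemma card_clique_longest c : longest_cycle c -> #|C| <= size c.
Proof.
move=> [_ maxc]; rewrite cardE; apply: maxc; rewrite /ucycle enum_uniq andbT.
apply: cycle_from_next; first exact: enum_uniq.
move=> x xC; apply: clique.
- by rewrite -mem_enum.
- by rewrite -mem_enum mem_next.
by rewrite eq_sym next_neq ?enum_uniq // -cardE ltnW.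
Qed.

(** * Attachments to a longest cycle *)

Section FixedCycle.

Variable c : seq T.
Hypothesis longc : longest_cycle c.

Let uc : uniq c. Proof. by case: longc => /andP[]. Qed.
Let cc : cycle H c. Proof. by case: longc => /andP[]. Qed.

Lemma card_rest_on_le : #|rest_on c| <= #|~: C|.
Proof. by apply/subset_leq_card/subsetP => x; rewrite !inE => /andP[]. Qed.

(** Inserting the path between [x] and its successor would lengthen [c]. *)
Lemma bypass x b p : x \in c -> uniq (b :: p) -> all [predC c] (b :: p) ->
  path H b p -> H x b -> H (last b p) (next c x) -> False.
Proof.
move=> xc up off pth Hxb Hl.
have [i [s [E l]]] := rot_next uc xc; set y := next c x in E l Hl.
have us : uniq (y :: s) by rewrite -E rot_uniq.
have cs : path H y (rcons s y) by have := cc; rewrite -(rot_cycle i) E.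
have [_ /(_ ((y :: s) ++ (b :: p)))] := longc.
rewrite size_cat -E size_rot => maxc.
suff /maxc : ucycle H (rot i c ++ b :: p) by rewrite /= ; lia.
rewrite E /ucycle; apply/andP; split; last first.
  rewrite cat_uniq us up andbT; apply/hasPn => a /(allP off) /=.
  by rewrite -(mem_rot i) E.
move: cs; rewrite rcons_path => /andP[ps _].
by rewrite /= rcons_cat cat_path ps /= rcons_path l Hxb pth Hl.
Qed.

(** A missing [z] could be inserted between two consecutive vertices of [C]. If there are none,
    [next] injects the part of [C] on [c] into [rest_on c], so [c] has at most [2 * #|~: C|]
    vertices, fewer than the clique. *)
Lemma clique_sub_longest : {subset C <= c}.
Proof.
move=> z zC; case: (boolP (z \in c)) => // zc; exfalso.
have [/existsP[a /and3P[ac aC naC]]|/existsPn nex] :=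
  boolP [exists a, [&& a \in c, a \in C & next c a \in C]].
  apply: (@bypass a z [::]) => //=; rewrite ?zc //; apply: clique => //.
    by apply: contraNneq zc => <-.
  by apply: contraNneq zc => ->; rewrite mem_next.
have sub : next c @: [set x in c | x \in C] \subset rest_on c.
  apply/subsetP => _ /imsetP[x xs ->]; move: xs; rewrite !inE mem_next => /andP[xc xC].
  by have := nex x; rewrite xc xC.
have := subset_leq_card sub; rewrite card_imset; last exact: can_inj (prev_next uc).
have := card_clique_longest longc; rewrite -(card_uniqP uc).
have <- : #|[set x in c | x \in C]| + #|rest_on c| = #|c|.
  rewrite -cardsUI (_ : _ :&: _ = set0) ?cards0 ?addn0.
    by apply: eq_card => x; rewrite !inE; case: (x \in c); case: (x \in C).
  by apply/setP => x; rewrite !inE; case: (x \in c); case: (x \in C).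
by have := card_rest_on_le; lia.
Qed.

Lemma off_cycle_sym : symmetric (off_cycle c).
Proof. by move=> a b; rewrite /off_cycle /= adj_sym; case: (a \in c); rewrite ?andbF ?andbT. Qed.

Lemma off_connect w b : w \notin c -> connect (off_cycle c) w b -> b \notin c.
Proof.
move=> wc con; apply/negP => bc.
have bC : b \notin [predC c] by rewrite inE /= negbK.
by have [x [y [_ yc /and3P[_ _ yc']]]] := connect_boundary con wc bC; rewrite inE /= yc' in yc.
Qed.

Lemma attach_link w x y : w \notin c -> x \in attach c w -> y \in attach c w ->
  exists b p, [/\ connect (off_cycle c) w b, H x b, H (last b p) y,
    path H b p & uniq (b :: p) /\ all [predC c] (b :: p)].
Proof.
move=> wc; rewrite !inE => /andP[_ /existsP[b /andP[wb bx]]].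
case/andP=> _ /existsP[b' /andP[wb' b'y]].
have : connect (off_cycle c) b b'.
  by apply: connect_trans wb'; rewrite (sym_connect_sym off_cycle_sym).
case/connectP => p pth; case/shortenP: pth => q pq uq _ E.
exists b, q; rewrite adj_sym bx -E b'y; split=> //.
  by apply: sub_path pq => a d /and3P[].
split=> //; rewrite /= (off_connect wc wb) /=.
elim: q b {wb bx E uq} pq => //= a q IH b /andP[/and3P[_ _ ac] pq].
by rewrite ac (IH a).
Qed.

Lemma next_attach w x : w \notin c -> x \in attach c w -> next c x \notin attach c w.
Proof.
move=> wc xX; apply/negP => nX.
have [b [p [_ xb lb pth [up off]]]] := attach_link wc xX nX.
by apply: (bypass _ up off pth xb lb); move: xX; rewrite inE => /andP[].
Qed.

(* The rotation of Chvatal and Erdos. *)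
Lemma next_attach_indep w x y : w \notin c -> x \in attach c w -> y \in attach c w ->
  ~~ H (next c x) (next c y).
Proof.
move=> wc xX yX; have [->|yx] := eqVneq y x; first by rewrite adj_irrefl.
apply/negP => Hn.
have xc : x \in c by move: xX; rewrite inE => /andP[].
have yc : y \in c by move: yX; rewrite inE => /andP[].
have [b [q [_ xb qy pthq [uq off]]]] := attach_link wc xX yX.
have [i [s [E l]]] := rot_next uc xc; set nx := next c x in E l Hn.
have us : uniq (nx :: s) by rewrite -E rot_uniq.
have ps : path H nx s.
  by have := cc; rewrite -(rot_cycle i) E /= rcons_path => /andP[].
have : y \in nx :: s by rewrite -E mem_rot.
have nyE : next (nx :: s) y = next c y by rewrite -E next_rot.
case/splitPr Ep: {1 2}(nx :: s) / => [p1 p2].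
have lp2 : last y p2 = x by rewrite -l -[RHS]/(last nx (nx :: s)) Ep last_cat.
case: p2 => [|h p2] in Ep lp2 *; first by rewrite -lp2 eqxx in yx.
have nyh : next c y = h.
  rewrite -nyE Ep next_nth mem_cat mem_head orbT.
  have ny1 : y \notin p1.
    by move: us; rewrite Ep cat_uniq /= negb_or => /and3P[_ /andP[]].
  case: (p1) ny1 => [|d p1'] ny1 /=; first by rewrite eqxx.
  rewrite inE negb_or in ny1; case/andP: ny1 => yd ny1.
  by rewrite eq_sym (negbTE yd) index_cat (negbTE ny1) /= eqxx addn0 nth_cat ltnNge leqnSn subSnn.
rewrite nyh in Hn.
have sorted_s : sorted H (rcons p1 y ++ h :: p2) by rewrite cat_rcons -Ep.
(* The longer cycle goes from [y] backwards to [next c x], across to [h], which is [next c y],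
   forwards to [x], and back to [y] through the path off [c]. *)
have [_ /(_ (rev (rcons p1 y) ++ (h :: p2) ++ b :: q))] := longc.
suff cyc : ucycle H (rev (rcons p1 y) ++ (h :: p2) ++ b :: q).
  move/(_ cyc); rewrite !size_cat size_rev size_rcons -(size_rot i c) E Ep size_cat /=.
  by move: (size p1) (size p2) (size q) => m1 m2 m3; clear; lia.
apply/andP; split; last first.
  have : perm_eq (rev (rcons p1 y) ++ (h :: p2) ++ b :: q) ((nx :: s) ++ b :: q).
    by rewrite Ep catA perm_cat2r -(cat_rcons y) perm_cat2r perm_rev.
  move/perm_uniq ->; rewrite cat_uniq us uq andbT.
  by apply/hasPn => a /(allP off) /=; rewrite -(mem_rot i) E.
have s1 : path H y (rev p1).
  rewrite -[path _ _ _]/(sorted H (y :: rev p1)) -rev_rcons rev_sorted.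
  rewrite (eq_sorted (e' := H)); last by move=> a d; rewrite adj_sym.
  by case: (cat_sorted2 sorted_s).
have s2 : path H h p2 by case: (cat_sorted2 sorted_s).
have l1 : last y (rev p1) = nx.
  by case: (p1) Ep => [|d p1'] [-> _] //; rewrite rev_cons last_rcons.
rewrite rev_rcons /= rcons_cat cat_path s1 l1 /= Hn rcons_cat cat_path s2 /=.
by rewrite (_ : last h p2 = x) // xb rcons_path pthq qy.
Qed.

(** As no two consecutive vertices are attachments, some vertex [d] of [c] is not one. The
    attachments separate [w] from [d], so [sep] applies. *)
Lemma card_attach w : w \notin c -> t <= #|attach c w|.
Proof.
move=> wc; rewrite leqNgt; apply/negP => lt.
have [d dc dX] : exists2 d, d \in c & d \notin attach c w.
  have := card_clique_longest longc; case E: c => [|x c'] /=; first by lia.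
  have xc : x \in c by rewrite E mem_head.
  rewrite -E => _; have [xX|xX] := boolP (x \in attach c w); last by exists x.
  by exists (next c x); rewrite ?mem_next // next_attach.
have wX : w \notin attach c w by rewrite inE (negbTE wc).
have con := sep lt wX dX.
pose A := [set b | connect (off_cycle c) w b].
have wA : w \in A by rewrite inE.
have dA : d \notin A by rewrite inE; apply/negP => /(off_connect wc); rewrite dc.
have [a [b [aA bA /andP[ab bX]]]] := connect_boundary con wA dA.
rewrite inE in aA; have ac := off_connect wc aA.
have [bc|bc] := boolP (b \in c).
  by case/negP: bX; rewrite inE bc /=; apply/existsP; exists a; rewrite aA.
case/negP: bA; rewrite inE; apply: connect_trans aA (connect1 _).
by rewrite /off_cycle /= ab ac.
Qed.

Lemma next_attach_sub w : next c @: attach c w :\: C \subset rest_on c.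
Proof.
apply/subsetP => _ /setDP[/imsetP[x + ->] nC].
by rewrite !inE mem_next nC andbT => /andP[].
Qed.

Lemma card_next_attachI w : w \notin c -> #|next c @: attach c w :&: C| <= 1.
Proof.
move=> wc; rewrite leqNgt; apply/negP => /card_gt1P[a [b []]].
rewrite !inE => /andP[/imsetP[x xX ->] xC] /andP[/imsetP[y yX ->] yC] xy.
by have := next_attach_indep wc xX yX; rewrite clique.
Qed.

Lemma card_attachID w :
  #|attach c w| = #|next c @: attach c w :&: C| + #|next c @: attach c w :\: C|.
Proof. by rewrite cardsID card_imset //; exact: can_inj (prev_next uc). Qed.

(** The successors of the attachments are pairwise non-adjacent, so at most one lies in the clique;
    the others lie in [rest_on c]. *)
Lemma card_attach_le w : w \notin c -> #|attach c w| <= #|rest_on c|.+1.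
Proof.
move=> wc; rewrite card_attachID; have := card_next_attachI wc.
by have := subset_leq_card (next_attach_sub w); lia.
Qed.

(** * Longest cycles with fewer than [t] vertices outside the clique *)

Hypothesis few : #|rest_on c| < t.

Lemma card_attachE w : w \notin c -> #|attach c w| = t /\ #|rest_on c| = t.-1.
Proof. by move=> wc; have := card_attach wc; have := card_attach_le wc; lia. Qed.

(** The bounds of [card_attach] and [card_attach_le] now meet, so every vertex of [rest_on c] is the
    successor of an attachment. *)
Lemma prev_rest_attach w v : w \notin c -> v \in rest_on c -> prev c v \in attach c w.
Proof.
move=> wc vR; have [cX cR] := card_attachE wc.
have /eqP E : next c @: attach c w :\: C == rest_on c.
  rewrite eqEcard next_attach_sub.
  by have := card_attachID w; have := card_next_attachI wc; lia.
by move: vR; rewrite -E => /setDP[/imsetP[x xX ->] _]; rewrite prev_next.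
Qed.

End FixedCycle.
(** Reversal exchanges [prev] and [next], which turns [prev_rest_attach] into [next_rest_attach]. *)
Lemma longest_cycle_rev c : longest_cycle c -> longest_cycle (rev c).
Proof.
move=> [/andP[cc uc] maxc]; split=> [|c' /maxc]; last by rewrite size_rev.
rewrite /ucycle rev_uniq uc andbT rev_cycle.
by rewrite (eq_cycle (e' := H)) // => x y; rewrite adj_sym.
Qed.

Lemma attach_rev c w : attach (rev c) w = attach c w.
Proof.
apply/setP => x; rewrite !inE mem_rev; congr (_ && _); apply: eq_existsb => b.
congr (_ && _); apply: eq_connect => a d.
by rewrite /off_cycle /= !mem_rev.
Qed.

Lemma rest_on_rev c : rest_on (rev c) = rest_on c.
Proof. by apply/setP => x; rewrite !inE mem_rev. Qed.

Lemma next_rest_attach c w v : longest_cycle c -> #|rest_on c| < t -> w \notin c ->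
  v \in rest_on c -> next c v \in attach c w.
Proof.
move=> lc few wc vR; have uc : uniq c by case: (lc) => /andP[].
rewrite -prev_rev // -attach_rev; apply: prev_rest_attach.
- exact: longest_cycle_rev.
- by rewrite rest_on_rev.
- by rewrite mem_rev.
- by rewrite rest_on_rev.
Qed.

Lemma attach_rest c w v : longest_cycle c -> #|rest_on c| < t -> w \notin c ->
  v \in rest_on c -> v \notin attach c w.
Proof.
move=> lc few wc vR; have uc : uniq c by case: (lc) => /andP[].
rewrite -[v](next_prev uc); apply: next_attach => //; exact: prev_rest_attach.
Qed.

Lemma attach_sub c w : longest_cycle c -> #|rest_on c| < t -> w \notin c ->
  attach c w \subset C.
Proof.
move=> lc few wc; apply/subsetP => x xX; apply/negPn/negP => xC.
have xR : x \in rest_on c by move: xX; rewrite !inE xC andbT => /andP[].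
by have := attach_rest lc few wc xR; rewrite xX.
Qed.

Lemma rest_on_indep c w v v' : longest_cycle c -> #|rest_on c| < t -> w \notin c ->
  v \in rest_on c -> v' \in rest_on c -> ~~ H v v'.
Proof.
move=> lc few wc vR vR'; have uc : uniq c by case: (lc) => /andP[].
rewrite -[v](next_prev uc) -[v'](next_prev uc).
by apply: (next_attach_indep lc wc); exact: prev_rest_attach.
Qed.

Lemma card_rest_off c : longest_cycle c ->
  #|[set w | w \notin c]| + #|rest_on c| = #|~: C|.
Proof.
move=> lc; rewrite -cardsUI (_ : _ :&: _ = set0) ?cards0 ?addn0.
  apply: eq_card => x; rewrite !inE; have := @clique_sub_longest c lc x.
  by case: (x \in c); case: (x \in C) => // /(_ isT).
by apply/setP => x; rewrite !inE; case: (x \in c).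
Qed.

Hypothesis t_gt1 : 1 < t.

Lemma rest_on_neq0 c w : longest_cycle c -> #|rest_on c| < t -> w \notin c ->
  exists v, v \in rest_on c.
Proof.
move=> lc few wc; apply/card_gt0P; have [_ ->] := card_attachE lc few wc; lia.
Qed.

(* The attachments do not depend on the component: since [c] is too long to alternate
   between [C] and its complement, [rest_on c] has at least [t] neighbours along [c]. *)
Lemma attachE c w : longest_cycle c -> #|rest_on c| < t -> w \notin c ->
  attach c w = next c @: rest_on c :|: prev c @: rest_on c.
Proof.
move=> lc few wc; have uc : uniq c by case: (lc) => /andP[].
have [cX cR] := card_attachE lc few wc.
set N := next c @: _; set P := prev c @: _.
have cN : #|N| = #|rest_on c| by rewrite card_imset //; exact: can_inj (prev_next uc).
have cP : #|P| = #|rest_on c| by rewrite card_imset //; exact: can_inj (next_prev uc).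
apply/esym/eqP; rewrite eqEcard; apply/andP; split.
  apply/subsetP => x /setUP[]/imsetP[v vR ->]; first exact: next_rest_attach.
  exact: prev_rest_attach.
rewrite cX leqNgt; apply/negP => lt.
(* By cardinality [N] and [P] coincide. Then [rest_on c :|: N] is closed under [next c] and contains
   all of [c], hence [C], which contradicts [big]. *)
have NE : N = N :|: P by apply/eqP; rewrite eqEcard subsetUl cN cR; lia.
have PE : P = N :|: P by apply/eqP; rewrite eqEcard subsetUr cP cR; lia.
have [v vR] := rest_on_neq0 lc few wc.
have : C \subset rest_on c :|: N.
  apply/subsetP => x xC; apply/negPn/negP => xY.
  have xc := clique_sub_longest lc xC.
  have vc : v \in c by move: vR; rewrite inE => /andP[].
  have con : fconnect (next c) v x by rewrite (fconnect_cycle (cycle_next uc) vc).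
  have vY : v \in rest_on c :|: N by rewrite inE vR.
  have [a [b [aY bY /eqP ab]]] := connect_boundary con vY xY.
  case/negP: bY; rewrite -ab; case/setUP: aY => [aR|]; first by rewrite inE imset_f ?orbT.
  rewrite NE -PE => /imsetP[a' aR ->]; rewrite next_prev //.
  by rewrite inE aR.
move/subset_leq_card; rewrite cardsU cN; have := card_rest_on_le c; have := big; lia.
Qed.

(** Replacing [v] by the path cannot lengthen [c], so the path is the single vertex [b], and the new
    cycle is again a longest one. *)
Lemma replace_vertex c v b p : longest_cycle c -> v \in c ->
  uniq (b :: p) -> all [predC c] (b :: p) -> path H b p ->
  H (prev c v) b -> H (last b p) (next c v) ->
  p = [::] /\ exists2 c', longest_cycle c' & c' =i [predU1 b & [predD1 c & v]].
Proof.
move=> lc vc up off pth Hb Hl; have uc : uniq c by case: (lc) => /andP[].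
have cc : cycle H c by case: (lc) => /andP[].
have [i s E] := rot_to vc.
have us : uniq (v :: s) by rewrite -E rot_uniq.
have cs : cycle H (v :: s) by rewrite -E rot_cycle.
have szc : size c = (size s).+1 by rewrite -(size_rot i) E.
have memc x : x \in c = (x == v) || (x \in s) by rewrite -(mem_rot i) E inE.
have sz1 : 2 < size c by apply: leq_trans (card_clique_longest lc); exact: C_gt2.
case: s => [|h s] in E us cs szc memc; first by rewrite szc in sz1.
have nE : next c v = h by rewrite -(next_rot i uc) E /= eqxx.
have pE : prev c v = last h s.
  rewrite -(prev_rot i uc) E prev_nth mem_head memNindex ?nth_last //.
  by case/andP: us.
rewrite nE in Hl; rewrite pE in Hb.
have cyc : ucycle H (h :: s ++ b :: p).
  apply/andP; split.
    move: cs => /= /andP[_]; rewrite rcons_path => /andP[ps _].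
    by rewrite rcons_cat cat_path ps /= Hb rcons_path pth.
  rewrite cons_uniq in us; rewrite -cat_cons cat_uniq up andbT; case/andP: us => _ ->.
  by apply/hasPn => x /(allP off) /=; rewrite memc negb_or => /andP[].
have p0 : p = [::].
  case: lc => _ /(_ _ cyc); rewrite szc /= size_cat /=; case: (p) => //= d p'.
  by clear; lia.
split=> //; exists (h :: s ++ b :: p).
  split=> // c' /(proj2 lc); rewrite p0 szc /= size_cat /=; by clear; lia.
move=> x; rewrite p0 -cat_cons mem_cat mem_seq1 !inE memc inE orbC.
case: (x == b) => //=; case: (eqVneq x v) => //= xv.
by case/andP: us; rewrite inE -xv => /negbTE.
Qed.

Lemma rest_on_replace c c' v b : v \in rest_on c -> b \notin c -> b \notin C ->
  c' =i [predU1 b & [predD1 c & v]] -> #|rest_on c'| = #|rest_on c|.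
Proof.
move=> vR bc bC E; rewrite (cardsD1 v (rest_on c)) vR.
have -> : rest_on c' = b |: rest_on c :\ v.
  by apply/setP => x; rewrite !inE E !inE; case: eqVneq => [->|] //=; rewrite ?bC ?andbA.
by rewrite cardsU1 !inE (negbTE bc) andbF.
Qed.

(** The component of [w] off [c] is a single vertex. Indeed, swap some [v] in [rest_on c] for a
    vertex [b] of it, giving [c']. A neighbour of [b] off [c] would be off [c'] and make [b] an
    attachment lying in [rest_on c'], against [attach_rest]. *)
Lemma off_cycle_nbr c w y : longest_cycle c -> #|rest_on c| < t -> w \notin c ->
  H w y = (y \in attach c w).
Proof.
move=> lc few wc; have uc : uniq c by case: (lc) => /andP[].
have [v vR] := rest_on_neq0 lc few wc.
have vc : v \in c by move: vR; rewrite inE => /andP[].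
have pX : prev c v \in attach c w by exact: prev_rest_attach.
have nX : next c v \in attach c w by exact: next_rest_attach.
have [b [p [wb Hb Hl pth [up off]]]] := attach_link wc pX nX.
have [p0 [c' lc' mc']] := replace_vertex lc vc up off pth Hb Hl.
have bc := off_connect wc wb.
have bC : b \notin C by apply: contra bc; exact: clique_sub_longest.
have few' : #|rest_on c'| < t by rewrite (rest_on_replace vR bc bC mc').
have lone b' : b' \notin c -> ~~ H b b'.
  move=> b'c; apply/negP => Hbb'.
  have b'c' : b' \notin c'.
    rewrite mc' !inE (negbTE b'c) andbF orbF.
    by apply: contraTneq Hbb' => ->; rewrite adj_irrefl.
  have bR : b \in rest_on c' by rewrite inE mc' !inE eqxx bC.
  case/negP: (attach_rest lc' few' b'c' bR).
  rewrite inE mc' !inE eqxx /=; apply/existsP; exists b'.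
  by rewrite connect0 adj_sym.
have wE : w = b.
  apply/eqP/negPn/negP => nwb; move: wb; rewrite (sym_connect_sym (@off_cycle_sym c)).
  move=> con; have [//|a [d [/eqP -> _ /and3P[Hd _ dc]]]] :=
    connect_boundary con (eqxx b : b \in pred1 b) (_ : w \notin pred1 b).
  by case/negP: (lone d dc).
subst b; apply/idP/idP => [Hwy|].
  have [yc|yc] := boolP (y \in c); last by case/negP: (lone _ yc).
  by rewrite inE yc; apply/existsP; exists w; rewrite connect0.
rewrite inE => /andP[_ /existsP[d /andP[con Hdy]]].
have [<- //|nwd] := eqVneq d w.
have [//|a [e [/eqP -> _ /and3P[He _ ec]]]] :=
    connect_boundary con (eqxx w : w \in pred1 w) (_ : d \notin pred1 w).
by case/negP: (lone e ec).
Qed.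

Hypothesis closed : forall x y, x != y -> ~~ H x y -> deg H x + deg H y < #|T|.

Lemma min_deg v : t < #|C| -> t <= deg H v.
Proof.
move=> tC; rewrite leqNgt; apply/negP => lt.
have [y yC yN] : exists2 y, y != v & y \notin [set y | H v y].
  have : 0 < #|~: (v |: [set y | H v y])|.
    have := cardsC (v |: [set y | H v y]); rewrite cardsU1.
    have : #|C| <= #|T| := max_card _; have := leq_b1 (v \notin [set y | H v y]).
    by move: lt; rewrite /deg; lia.
  by case/card_gt0P=> y; rewrite !inE negb_or => /andP[]; exists y; rewrite ?inE.
have vN : v \notin [set y | H v y] by rewrite inE adj_irrefl.
have con := sep lt vN yN.
have [//|a [b [/eqP -> _ /andP[Hb]]]] :=
  connect_boundary con (eqxx v : v \in pred1 v) (_ : y \notin pred1 v).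
by rewrite inE Hb.
Qed.

(** [X] is the common attachment set of the vertices off [c]. Closedness joins the vertices of
    [rest_on c] to all of [X], and swapping such a vertex with [w] shows that it has no other
    neighbours. *)
Theorem longest_cycle_extremal c : longest_cycle c -> #|rest_on c| < t ->
  ~~ (~: C \subset c) ->
  exists X : {set T}, [/\ X \subset C, #|X| = t &
    forall v y, v \notin C -> H v y = (y \in X)].
Proof.
move=> lc few /subsetPn[w wC wc]; rewrite inE in wC.
have [cX cR] := card_attachE lc few wc.
have XC := attach_sub lc few wc.
have XE w' : w' \notin c -> attach c w' = attach c w by move=> w'c; rewrite !attachE.
set X := attach c w in cX XC XE.
have offE w' y : w' \notin c -> H w' y = (y \in X).
  by move=> w'c; rewrite (off_cycle_nbr _ lc few w'c) XE.
have Wcard := card_rest_off lc.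
(* A vertex [x] of [X] is adjacent to the rest of [C] and to everything off [c], in all at least
   [#|T| - t] vertices, while [v] has degree at least [t]; so [closed] excludes a non-edge. *)
have full v x : v \in rest_on c -> x \in X -> H v x.
  move=> vR xX; apply/negPn/negP => nvx.
  have xC := subsetP XC x xX.
  have vC : v \notin C by move: vR; rewrite inE => /andP[].
  have vx : v != x by apply: contraNneq vC => ->.
  have := closed vx nvx.
  have tC : t < #|C|.
    have : 0 < #|[set w' | w' \notin c]| by apply/card_gt0P; exists w; rewrite inE.
    by have := big; lia.
  have := min_deg v tC.
  have : #|C :\ x| + #|[set w' | w' \notin c]| <= deg H x.
    rewrite -cardsUI (_ : _ :&: _ = set0) ?cards0 ?addn0.
      apply/subset_leq_card/subsetP => y; rewrite !inE => /orP[/andP[yx yC]|yc].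
        by apply: clique => //; rewrite eq_sym.
      by rewrite adj_sym offE.
    apply/setP => y; rewrite !inE; apply/negP => /andP[/andP[_ yC]].
    by rewrite (clique_sub_longest lc yC).
  by have := cardsD1 x C; rewrite xC; have := cardsC C; lia.
exists X; split=> // v y vC.
have [vc|/offE //] := boolP (v \in c).
have vR : v \in rest_on c by rewrite inE vc.
apply/idP/idP => [Hvy|]; last exact: full.
have yC : y \in C.
  apply/negPn/negP => yC; have [yc|yc] := boolP (y \in c).
    have yR : y \in rest_on c by rewrite inE yc.
    by have := rest_on_indep lc few wc vR yR; rewrite Hvy.
  by move: Hvy; rewrite adj_sym offE // => /(subsetP XC); rewrite (negbTE vC).
(* Replace [v] by [w] on the cycle. Now [v] is off the cycle, so it has exactly [t] neighbours, and
   these include the [t] elements of [X]. *)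
have Hp : H (prev c v) w by rewrite adj_sym offE //; exact: prev_rest_attach.
have Hn : H (last w [::]) (next c v) by rewrite /= offE //; exact: next_rest_attach.
have off : all [predC c] [:: w] by rewrite /= wc.
have [_ [c' lc' mc']] := @replace_vertex c v w [::] lc vc isT off isT Hp Hn.
have vc' : v \notin c'.
  by rewrite mc' !inE eqxx /= orbF; apply: contraTneq vc => ->.
have few' : #|rest_on c'| < t by rewrite (rest_on_replace vR wc wC mc').
have [cX' _] := card_attachE lc' few' vc'.
suff /eqP -> : X == attach c' v by rewrite -(off_cycle_nbr _ lc' few' vc').
rewrite eqEcard cX cX' leqnn andbT; apply/subsetP => x xX.
by rewrite -(off_cycle_nbr _ lc' few' vc') full.
Qed.

End LongestCycle.

(** * Edge counting, cones and the exceptional graph *)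

Lemma card_edges_le (T : finType) (G : sgraph T) (C : {set T}) :
  #|edges G| <= 'C(#|C|, 2) + \sum_(v in ~: C) deg G v.
Proof.
rewrite -cards_draws.
pose U := \bigcup_(v in ~: C) [set [set v; y] | y in [set y | G v y]].
have leU : #|U| <= \sum_(v in ~: C) deg G v.
  rewrite /U; elim/big_ind2: _ => [|m A m' B hA hB|v _]; first by rewrite cards0.
    by rewrite cardsU; lia.
  exact: leq_imset_card.
apply: leq_trans (leq_add (leqnn _) leU); rewrite -cardsUI.
apply: leq_trans (leq_addr _ _); apply/subset_leq_card/subsetP => e.
case/imset2P=> x y _; rewrite inE => /andP[_ Gxy] ->; rewrite in_setU.
have [xC|xC] := boolP (x \in C); last first.
  apply/orP; right; apply/bigcupP; exists x; first by rewrite inE.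
  by apply: imset_f; rewrite inE.
have [yC|yC] := boolP (y \in C); last first.
  apply/orP; right; apply/bigcupP; exists y; first by rewrite inE.
  by rewrite setUC; apply: imset_f; rewrite inE adj_sym.
rewrite inE cards2 subUset !sub1set xC yC /=.
by rewrite (_ : x != y) //; apply: contraTneq Gxy => ->; rewrite adj_irrefl.
Qed.

Lemma handshake_le (T : finType) (G : sgraph T) :
  2 * #|edges G| <= \sum_x deg G x.
Proof.
have -> : 2 * #|edges G| = \sum_(e in edges G) \sum_(x in e) 1.
  rewrite mulnC -sum_nat_const; apply: eq_bigr => e /imset2P[x y _].
  rewrite inE => /andP[_ Gxy] ->; rewrite sum1_card cards2.
  by rewrite (_ : x != y) //; apply: contraTneq Gxy => ->; rewrite adj_irrefl.
rewrite (exchange_big_dep predT) //=; apply: leq_sum => x _.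
rewrite sum1dep_card.
apply: leq_trans (leq_imset_card (fun y => [set x; y]) [set y | G x y]).
apply/subset_leq_card/subsetP => e; rewrite inE => /andP[/imset2P[a b _]].
rewrite inE => /andP[_ Gab] ->; rewrite !inE => /orP[]/eqP ->.
  by apply: imset_f; rewrite inE.
by rewrite setUC; apply: imset_f; rewrite inE adj_sym.
Qed.

Lemma bin2_double m : 2 * 'C(m, 2) = m * (m - 1).
Proof. by rewrite mulnC -[X in _ * X]/(2`!) bin_ffact !ffactnS ffactn0 muln1 subn1. Qed.

(** Here [s] stands for [k + t] and [r] for the number of vertices outside a maximum clique, each of
    degree at most [r - 1]. At [r = s] the upper bound is one below the target, and it is no larger
    for greater [r] up to [n / 2]. *)
Lemma edge_bound_small n s r e : 1 < s -> 6 * s - 1 <= n -> s <= r -> 2 * r <= n ->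
  e <= 'C(n - r, 2) + r * (r - 1) ->
  e < 'C(n - s, 2) + (s - 1) ^ 2 + s.
Proof.
move=> s1 ns sr rn le.
have [m Em] : exists m, n = 2 * r + m by exists (n - 2 * r); lia.
have [i Ei] : exists i, r = s + i by exists (r - s); lia.
have [s' Es] : exists s', s = s'.+2 by exists (s - 2); lia.
have := bin2_double (n - r); have := bin2_double (n - s); subst n r s.
move: le.
have -> : 2 * (s'.+2 + i) + m - s'.+2 = (s' + 2 * i + m + 1).+1 by lia.
have -> : 2 * (s'.+2 + i) + m - (s'.+2 + i) = (s' + i + m + 1).+1 by lia.
have -> : s'.+2 + i - 1 = s' + i + 1 by lia.
rewrite !subn1 /= => le E1 E2.
(* From [r = s] to [r = s + i] the bound drops by [i * (2 * m + i + 1 - 2 * s) / 2], which is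
   non-negative because [n] is at least [6 * s - 1]. *)
have : i * (2 * s' + 4) <= i * (2 * m + i + 1) by apply: leq_mul => //; lia.
move: le E1 E2; move: 'C(_, 2) 'C(_, 2) => B B'; clear; nia.
Qed.

(** This serves cliques of fewer than [n / 2] vertices: [a] counts the vertices of degree at least
    [(n - 1) / 2], and [d] bounds the other degrees. *)
Lemma edge_bound_large n s a d e : 1 < s -> 6 * s - 1 <= n -> 2 * a <= n - 1 ->
  2 * d < n - 1 -> 2 * e <= a * (n - 1) + (n - a) * d ->
  e < 'C(n - s, 2) + (s - 1) ^ 2 + s.
Proof.
move=> s1 ns an dn le.
(* Near [n = 6 * s] the target also has leading term [3 * n ^ 2 / 8], as 25/72 + 1/36 = 3/8, so the
   linear term decides. *)
have e_le : 8 * e + 6 * n <= 3 * n ^ 2.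
  have E := odd_double_half n; case: (odd n) E => /= E.
    have ah : a <= n./2 by lia.
    have [h Eh] : exists h, n./2 = h.+1 by exists (n./2 - 1); lia.
    have dh : d <= h by lia.
    have l1 : (n - a) * d <= (n - a) * h by rewrite leq_mul.
    have l2 : a * h.+2 <= h.+1 * h.+2 by rewrite leq_mul // -Eh.
    have En : n = h.*2 + 3 by lia.
    have [b Eb] : exists b, n = a + b by exists (n - a); lia.
    rewrite Eb addKn in l1 le; rewrite Eb; clear -l1 l2 le En Eb.
    have -> : b = h.*2 + 3 - a by lia.
    nia.
  have [h Eh] : exists h, n./2 = h.+1 by exists (n./2 - 1); lia.
  have ah : a <= h by lia.
  have dh : d <= h by lia.
  have l1 : (n - a) * d <= (n - a) * h by rewrite leq_mul.
  have l2 : a * h.+1 <= h * h.+1 by rewrite leq_mul.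
  have En : n = h.*2 + 2 by lia.
  have [b Eb] : exists b, n = a + b by exists (n - a); lia.
  rewrite Eb addKn in l1 le; rewrite Eb; clear -l1 l2 le En Eb.
  have -> : b = h.*2 + 2 - a by lia.
  nia.
have := bin2_double (n - s).
have [s' Es] : exists s', s = s'.+2 by exists (s - 2); lia.
have [m Em] : exists m, n = m + 6 * s - 1 by exists (n + 1 - 6 * s); lia.
subst s n; move: e_le.
have -> : m + 6 * s'.+2 - 1 - s'.+2 = (m + 5 * s' + 8).+1 by lia.
have -> : m + 6 * s'.+2 - 1 = m + 6 * s' + 11 by lia.
rewrite !subn1 /= => e_le; move: 'C(_, 2) => B E1.
clear -e_le E1; nia.
Qed.

(** Take a maximum clique [C]. A vertex outside it has a non-neighbour in [C], whose degree is at
    least [#|C| - 1], so its own degree is less than [#|~: C|]. If [#|~: C|] were at least [s],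
    there would be too few edges. *)
Lemma closed_large_clique (T : finType) (H : sgraph T) s : 1 < s ->
  6 * s - 1 <= #|T| ->
  (forall x y, x != y -> ~~ H x y -> deg H x + deg H y < #|T| - 1) ->
  'C(#|T| - s, 2) + (s - 1) ^ 2 + s <= #|edges H| ->
  exists2 C : {set T}, {in C &, forall x y, x != y -> H x y} & #|~: C| < s.
Proof.
move=> s1 ns closed eH; pose n := #|T|.
pose Q (A : {set T}) := [forall x in A, forall y in A, (x != y) ==> H x y].
have QP (A : {set T}) : reflect {in A &, forall x y, x != y -> H x y} (Q A).
  apply: (iffP forall_inP) => [h x y xA yA xy|h x xA].
    by have /forall_inP/(_ y yA)/implyP := h x xA; apply.
  by apply/forall_inP => y yA; apply/implyP; apply: h.
have Q0 : Q set0 by apply/forall_inP => x; rewrite inE.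
case: (arg_maxnP (fun A : {set T} => #|A|) Q0) => C /QP cC maxC.
exists C => //; rewrite ltnNge; apply/negP => sr.
have rE := cardsC C.
move: eH; apply/negP; rewrite -ltnNge.
have degC x : x \in C -> #|C| - 1 <= deg H x.
  move=> xC; rewrite (cardsD1 x) xC addKn; apply/subset_leq_card/subsetP => y.
  by rewrite !inE => /andP[yx yC]; apply: cC => //; rewrite eq_sym.
have out v : v \in ~: C -> deg H v <= #|~: C| - 1.
  rewrite inE => vC.
  have [/existsP[u /andP[uC nH]]|/existsPn h] := boolP [exists u, (u \in C) && ~~ H v u].
    have vu : v != u by apply: contraNneq vC => ->.
    by have := closed _ _ vu nH; have := degC _ uC; lia.
  have /maxC : Q (v |: C).
    have hv u : u \in C -> H v u by move=> uC; have := h u; rewrite uC negbK.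
    apply/QP => x y; rewrite !inE => /orP[/eqP->|xC] /orP[/eqP->|yC] xy.
    - by rewrite eqxx in xy.
    - exact: hv.
    - by rewrite adj_sym hv.
    - exact: cC.
  by rewrite /= cardsU1 vC; lia.
have [rn|rn] := leqP (2 * #|~: C|) n.
  apply: (@edge_bound_small _ _ #|~: C|) => //.
  rewrite -rE addnK; apply: leq_trans (card_edges_le H C) _.
  by rewrite leq_add2l -sum_nat_const; apply: leq_sum.
(* Two vertices of [A] have degree sum at least [n - 1], so [A] is a clique, no larger than [C]. *)
pose A := [set x | n - 1 <= 2 * deg H x].
have QA : Q A.
  apply/QP => x y; rewrite !inE => hx hy xy; apply/negPn/negP => nH.
  by have := closed _ _ xy nH; move: hx hy; rewrite -/n; lia.
have := maxC _ QA => /= Ale.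
apply: (@edge_bound_large _ _ #|A| ((n - 2) %/ 2)) => //; rewrite -/n.
- by move: rE rn Ale; rewrite -/n; lia.
- by move: ns; rewrite -/n; lia.
apply: leq_trans (handshake_le H) _; rewrite (bigID (mem A)) /=.
have <- : #|~: A| = n - #|A| by rewrite /n -(cardsC A) addKn.
rewrite -!sum_nat_const leq_add //.
  apply: leq_sum => x _.
  have : deg H x <= #|~: [set x]|.
    by apply/subset_leq_card/subsetP => y; rewrite !inE; apply: contraTneq => ->; rewrite adj_irrefl.
  by have := cardsC [set x]; rewrite cards1 -/n; lia.
rewrite (eq_bigl (mem (~: A))); last by move=> x; rewrite !inE.
by apply: leq_sum => x; rewrite !inE -ltnNge; lia.
Qed.

(** Hang the remaining vertices on the path. Inner vertices of the path have a parent and a child,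
    so only its ends and the vertices off it can be leaves. *)
Lemma path_spanning_tree (T : finType) (H : sgraph T) k z p :
  (forall x y, connect H x y) -> path H z p -> uniq (z :: p) ->
  #|[set x | x \notin z :: p]| + 2 <= k -> has_spanning_ended_tree k H.
Proof.
move=> conH pth up offk.
have [|par0 [rho hp]] := @connected_parent T H [set x in z :: p] conH.
  by apply/set0Pn; exists z; rewrite !inE eqxx.
(* The index of [x] in [p] is the index of its predecessor in [z :: p]. *)
pose par x := if x \in p then nth z (z :: p) (index x p) else par0 x.
have zp : z \notin p by case/andP: up.
have up' : uniq p by case/andP: up.
have hpar x : x != z -> x \notin p -> H x (par x) /\ rho (par x) < rho x.
  by move=> xz xp; rewrite /par (negbTE xp); apply: hp; rewrite !inE negb_or xz.
pose rho' x := if x \in z :: p then index x (z :: p) else (size p).+1 + rho x.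
have tr : forall x, fconnect par x z.
  apply: (@ranked_fconnect _ _ rho') => x xz.
  have [xp|xp] := boolP (x \in p).
    have ix : index x p < size (z :: p) by rewrite /= ltnS ltnW // index_mem.
    rewrite /par xp /rho' mem_nth // index_uniq // inE xp orbT /=.
    by rewrite eq_sym (negbTE xz).
  have [_ hr] := hpar x xz xp.
  rewrite {2}/rho' inE (negbTE xz) (negbTE xp) /= /rho'.
  case: ifP => [pp|_]; last by rewrite ltn_add2l.
  by apply: leq_trans (leq_addr _ _); rewrite -index_mem in pp.
apply: (spanning_ended_treeI (tr := tr)).
  move=> x xz; have [xp|xp] := boolP (x \in p); last by case: (hpar x xz xp).
  rewrite adj_sym /par xp; have /(pathP z)/(_ (index x p)) := pth.
  by rewrite index_mem nth_index //; apply.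
apply: leq_trans offk; rewrite addnC.
apply: (@leq_trans #|[set z; last z p] :|: [set x | x \notin z :: p]|); last first.
  by rewrite cardsU; have := cards2 z (last z p); have := leq_b1 (z != last z p); lia.
apply/subset_leq_card/subsetP => x; rewrite !inE negb_or deg_rooted_tree.
have [//|xz /=] := eqVneq x z; have [//|xl /=] := eqVneq x (last z p).
apply: contraTN => xp.
have lti : index x p < size p by rewrite index_mem.
have lti' : (index x p).+1 < size p.
  rewrite ltn_neqAle lti andbT; apply: contraNneq xl => E.
  by rewrite -nth_last -E /= nth_index.
pose y := nth z p (index x p).+1.
have yp : y \in p by apply: mem_nth.
suff : 0 < #|[set y | (y != z) && (par y == x)]| by lia.
apply/card_gt0P; exists y; rewrite inE; apply/andP; split.
  by apply: contraNneq zp => <-.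
by rewrite /par yp index_uniq //= nth_index.
Qed.

Lemma connect_map (T U : finType) (f : T -> U) (e : rel T) (e' : rel U) x y :
  (forall a b, e a b -> e' (f a) (f b)) -> connect e x y -> connect e' (f x) (f y).
Proof.
move=> h /connectP[p + ->]; elim: p x => [|a p IH] x //= /andP[xa /IH].
by apply: connect_trans; apply: connect1; exact: h.
Qed.

(** * Cones over a graph *)

Section Cone.

Variables (T : finType) (H : sgraph T).

Definition cone_adj : rel (option T) := fun u v =>
  match u, v with
  | Some x, Some y => H x y
  | None, None => false
  | _, _ => true
  end.

Definition cone : sgraph (option T).
Proof. by exists cone_adj => [[x|] [y|]|[x|]] //=; rewrite ?adj_irrefl // adj_sym. Defined.

Lemma deg_cone x : deg cone (Some x) = (deg H x).+1.
Proof.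
rewrite /deg -(card_imset (mem [set y | H x y]) (@Some_inj _)) -add1n.
rewrite (cardsD1 None [set y | cone (Some x) y]) inE /=; congr (_ + _).
apply: eq_card => -[y|]; rewrite !inE /=.
  by apply/idP/imsetP => [Hxy|[y' + [->]]]; [exists y; rewrite ?inE | rewrite inE].
by apply/esym/imsetP => -[].
Qed.

Lemma cone_sep t :
  (forall S : {set T}, #|S| < t -> forall x y, x \notin S -> y \notin S ->
     connect [rel a b | H a b && (b \notin S)] x y) ->
  forall S : {set option T}, #|S| < t.+1 -> forall x y, x \notin S -> y \notin S ->
     connect [rel a b | cone a b && (b \notin S)] x y.
Proof.
move=> sep S St x y xS yS.
have [nS|nS] := boolP (None \in S); last first.
  apply: (@connect_trans _ _ None).
    by case: x xS => [x|] xS //; apply: connect1; rewrite /= nS.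
  by case: y yS => [y|] yS //; apply: connect1; rewrite /= yS.
case: x xS => [x|] xS; last by rewrite nS in xS.
case: y yS => [y|] yS; last by rewrite nS in yS.
pose S' := [set a | Some a \in S].
have S't : #|S'| < t.
  have le : #|S'| <= #|S :\ None|.
    rewrite -(card_imset (mem S') (@Some_inj _)); apply/subset_leq_card/subsetP.
    by move=> _ /imsetP[a aS ->]; rewrite !inE in aS *.
  by move: St; rewrite (cardsD1 None S) nS add1n ltnS; exact: leq_ltn_trans.
have con := sep S' S't x y; rewrite !inE in con.
apply: (connect_map (f := some) _ (con xS yS)) => a b /andP[Hab].
by rewrite inE /= Hab.
Qed.

End Cone.

Lemma t_connected_sep (T : finType) (G : sgraph T) t : t_connected t G ->
  forall S : {set T}, #|S| < t -> forall x y, x \notin S -> y \notin S ->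
    connect [rel a b | G a b && (b \notin S)] x y.
Proof.
move=> [_ con] S /con[_ {}con] x y; rewrite -!in_setC => xS yS.
have := con (exist _ x xS) (exist _ y yS).
apply: (connect_map (f := val)) => a b /= Gab.
by apply/andP; split; [exact: Gab | have := valP b; rewrite /= inE].
Qed.

Lemma joins_sub l (T : finType) (G H : sgraph T) : joins l G H -> subrel G H.
Proof. by elim=> [|H' p _ IH _] x y //= /IH ->. Qed.

Lemma extremal_iso (T : finType) (H : sgraph T) (C X : {set T}) a b d :
  {in C &, forall x y, x != y -> H x y} -> X \subset C ->
  (forall v y, v \notin C -> H v y = (y \in X)) ->
  #|X| = a -> #|C :\: X| = b -> #|~: C| = d ->
  iso H (join (complete a) (dunion (complete b) (empty d))).
Proof.
move=> clique XC HR ca cb cd; subst a b d.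
pose g (u : 'I_#|X| + ('I_#|C :\: X| + 'I_#|~: C|)) : T :=
  match u with
  | inl i => enum_val i
  | inr (inl i) => enum_val i
  | inr (inr i) => enum_val i
  end.
have gX i : enum_val i \in X := enum_valP i.
have gXC i : @enum_val _ (mem X) i \in C := subsetP XC _ (gX i).
have gD (i : 'I_#|C :\: X|) : enum_val i \notin X /\ enum_val i \in C.
  by have := enum_valP i; rewrite !inE => /andP[].
have gR (i : 'I_#|~: C|) : enum_val i \notin C by have := enum_valP i; rewrite inE.
have ginj : injective g.
  move=> [i|[i|i]] [j|[j|j]] //= E.
  - by rewrite (enum_val_inj E).
  - by have [] := gD j; rewrite -E gX.
  - by have := gR j; rewrite -E gXC.
  - by have [] := gD i; rewrite E gX.
  - by rewrite (enum_val_inj E).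
  - by have := gR j; rewrite -E; have [_ ->] := gD i.
  - by have := gR i; rewrite E gXC.
  - by have := gR i; rewrite E; have [_ ->] := gD j.
  - by rewrite (enum_val_inj E).
have card_eq : #|T| <= #|{: 'I_#|X| + ('I_#|C :\: X| + 'I_#|~: C|)}|.
  rewrite !card_sum !card_ord addnA -{1}(setIidPr XC) cardsID.
  by rewrite cardsC.
have [f fK gK] := inj_card_bij ginj card_eq.
have cliqueE x y : x \in C -> y \in C -> H x y = (x != y).
  move=> xC yC; have [->|xy] := eqVneq x y; first by rewrite adj_irrefl.
  exact: clique.
have gE u v : join (complete _) (dunion (complete _) (empty _)) u v = H (g u) (g v).
  case: u v => [i|[i|i]] [j|[j|j]] /=.
  - by rewrite cliqueE // (inj_eq enum_val_inj).
  - have [nX jC] := gD j; rewrite cliqueE //; apply/esym.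
    by apply: contraNneq nX => <-.
  - by rewrite adj_sym HR ?gX ?gR.
  - have [nX jC] := gD i; rewrite cliqueE //; apply/esym.
    by apply: contraNneq nX => ->.
  - have [_ iC] := gD i; have [_ jC] := gD j.
    by rewrite cliqueE // (inj_eq enum_val_inj).
  - by have [/negbTE nX _] := gD i; rewrite adj_sym HR ?nX ?gR.
  - by rewrite HR ?gX ?gR.
  - by have [/negbTE nX _] := gD j; rewrite HR ?nX ?gR.
  - by rewrite HR //; apply/esym; apply: contraNF (gR j); exact: (subsetP XC).
exists f; first by exists g.
by move=> x y; rewrite gE !gK.
Qed.

Lemma cone_cycle_path (T : finType) (H : sgraph T) c : None \in c -> 1 < size c ->
  ucycle (cone H) c ->
  exists z p, [/\ path H z p, uniq (z :: p) & forall x, (x \in z :: p) = (Some x \in c)].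
Proof.
move=> nc sc /andP[cc uc]; have [i s E] := rot_to nc.
have : uniq (None :: s) by rewrite -E rot_uniq.
have : cycle (cone H) (None :: s) by rewrite -E rot_cycle.
have memc x : (Some x \in c) = (Some x \in s) by rewrite -(mem_rot i) E inE.
have : 1 < size (None :: s) by rewrite -E size_rot.
rewrite /= => s1 + /andP[nS us].
have [q Eq] : exists q, s = map some q.
  elim: (s) nS => [|[x|] s' IH]; rewrite ?inE //=; first by exists [::].
  by case/IH=> q ->; exists (x :: q).
case: q Eq => [|z p] Eq; first by rewrite Eq in s1.
rewrite Eq /= rcons_path => /andP[pth _]; exists z, p; split.
- by move: pth; rewrite path_map.
- by move: us; rewrite Eq map_inj_uniq //; exact: Some_inj.
- by move=> x; rewrite memc Eq mem_map //; exact: Some_inj.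
Qed.

Theorem theorem1p6 (k t n : nat) (T : finType) (G : sgraph T) :
  2 <= k -> 1 <= t -> #|T| = n -> t_connected t G ->
  maxn (6 * k + 6 * t - 1) (k ^ 2 + t * k + t + 1) <= n ->
  'C(n - k - t, 2) + (k + t - 1) ^ 2 + k + t <= #|edges G| ->
  ~ iso (lclosure (n - 1) G)
      (join (complete t) (dunion (complete (n - k - 2 * t + 1)) (empty (k + t - 1)))) ->
  has_spanning_ended_tree k G.
Proof.
move=> k2 t1 nE conG; rewrite geq_max => /andP[n6 _] eG niso.
have jGH := lclosure_joins (n - 1) G; have stopH := @lclosure_stop (n - 1) T G.
set H := lclosure (n - 1) G in niso jGH stopH.
have subGH := joins_sub jGH.
have jGH' : joins (#|T| - 1) G H by rewrite nE.
apply: (spanning_tree_joins jGH').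
have closed x y : x != y -> ~~ H x y -> deg H x + deg H y < #|T| - 1.
  by move=> xy nH; have := stopH (x, y); rewrite /joinable xy nH /= -ltnNge nE.
have sep (S : {set T}) : #|S| < t -> forall x y, x \notin S -> y \notin S ->
    connect [rel a b | H a b && (b \notin S)] x y.
  move=> St x y xS yS; have := t_connected_sep conG St xS yS.
  by apply: (connect_map (f := id)) => a b /andP[/subGH /= -> ->].
have conH x y : connect H x y.
  have := @sep set0 _ x y; rewrite cards0 !inE => /(_ t1 isT isT).
  by apply: (connect_map (f := id)) => a b /andP[].
have [|||C clique rC] := @closed_large_clique T H (k + t) _ _ closed.
- by lia.
- by rewrite nE; lia.
- rewrite nE subnDA; apply: leq_trans (_ : _ <= #|edges G|) _; first by rewrite addnA.
  apply/subset_leq_card/subsetP => e /imset2P[x y _]; rewrite inE => /andP[_ /subGH Hxy] ->.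
  by apply: imset2_f; rewrite ?inE.
have CE := cardsC C; rewrite nE {eG} in CE.
pose D := None |: [set Some x | x in C].
have SomeD x : (Some x \in D) = (x \in C).
  by rewrite 2!inE (mem_imset _ _ (@Some_inj _)).
have cD : #|D| = #|C|.+1.
  rewrite cardsU1 card_imset ?(introN imsetP) //; last exact: Some_inj.
  by case.
have cDC : #|~: D| = #|~: C|.
  by have := cardsC D; rewrite cD card_option nE; lia.
have cliqueD : {in D &, forall x y, x != y -> cone H x y}.
  by move=> [x|] [y|] //; rewrite !SomeD; exact: clique.
have bigD : 2 * #|~: D| < #|D| by rewrite cDC cD; lia.
have D2 : 2 < #|D| by rewrite cD; lia.
have sepD := cone_sep sep.
(* Both degrees grow by one in the cone, so the bound [n - 1] becomes [n + 1], the order of the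
   cone. *)
have closedD x y : x != y -> ~~ cone H x y -> deg (cone H) x + deg (cone H) y < #|{: option T}|.
  case: x y => [x|] [y|] //= xy nH; rewrite !deg_cone card_option.
  have xy' : x != y by apply: contraNneq xy => ->.
  by have := closed _ _ xy' nH; rewrite nE; lia.
have [c lc] := ex_longest_cycle (cone H).
have Dc := clique_sub_longest cliqueD bigD D2 lc.
have rest : #|[set w | w \notin c]| + #|rest_on D c| = #|~: C|.
  by rewrite -cDC; exact: (card_rest_off cliqueD bigD D2 lc).
have nc : None \in c by apply: Dc; rewrite !inE.
have sc : 1 < size c by apply: leq_trans (ltnW D2) (card_clique_longest cliqueD D2 lc).
have [z [p [pth up mc]]] := cone_cycle_path nc sc (proj1 lc).
have offE : #|[set x | x \notin z :: p]| = #|[set w | w \notin c]|.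
  rewrite -(card_imset _ (@Some_inj _)); apply: eq_card => -[x|]; rewrite !inE.
    by rewrite (mem_imset _ _ (@Some_inj _)) inE mc.
  by rewrite nc; apply/imsetP => -[].
apply: (path_spanning_tree conH pth up); rewrite offE.
have [subc|nsub] := boolP (~: D \subset c).
  rewrite (_ : [set _ | _] = set0) ?cards0 //; apply/setP => w; rewrite !inE.
  have [wD|wD] := boolP (w \in D); first by rewrite Dc.
  by rewrite (subsetP subc) // inE.
(* With at least [t + 1] of the at most [k + t - 1] vertices outside [C] on the cycle, at most
   [k - 2] are missed. Otherwise the extremal theorem applies to the cone, with [t + 1] in place of
   [t]. *)
have [few|many] := ltnP #|rest_on D c| t.+1; last by lia.
have [|X [XD cX HX]] := longest_cycle_extremal cliqueD bigD D2 sepD _ closedD lc few nsub.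
  by lia.
have [w wD wc] : exists2 w, w \notin D & w \notin c.
  by case/subsetPn: nsub => w; rewrite inE; exists w.
have restE : #|rest_on D c| = t.
  exact: (proj2 (card_attachE cliqueD bigD D2 sepD lc few wc)).
(* Now exactly [t] vertices outside [C] lie on the cycle, so more than [k - 2] are missed only when
   [#|~: C|] is [k + t - 1]. Dropping the apex from [X] then leaves the [t] dominating vertices of
   the exceptional graph. *)
have [r_small|r_big] := leqP (#|~: C| + 2) (k + t); first by lia.
case: niso.
pose Y := [set x | Some x \in X].
have nX : None \in X by rewrite -(HX w) //; case: w wD {wc} => //; rewrite !inE.
have YC : Y \subset C by apply/subsetP => x; rewrite inE => /(subsetP XD); rewrite SomeD.
have cY : #|Y| = t.
  have -> : #|Y| = #|X :\ None|.
    rewrite -(card_imset (mem Y) (@Some_inj _)); apply: eq_card => -[x|].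
      by rewrite (mem_imset _ _ (@Some_inj _)) !inE.
    by rewrite !inE; apply/imsetP => -[].
  by have := cardsD1 None X; rewrite nX cX => -[].
apply: (extremal_iso clique YC) => //.
- by move=> v y vC; rewrite inE -(HX (Some v)) // SomeD.
- by rewrite cardsD (setIidPr YC) cY; lia.
- by lia.
Qed.
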